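(* Let $M=(a_{ij})$ be a real $p\times q$ matrix and let $k\ge 1$. Let $\rho$ be either $\gamma_{s,m}$ for some column index $s$ and some nonzero integer $m$, or $\epsilon_{s,l,h}$ for some distinct column indices $s,l$ and some integer $h$. Suppose that every $k\times k$ minor of $M$ whose row set contains the first row is an integer. Then every $k\times k$ minor of $\rho(M)$ whose row set contains the first row (i.e. the minor of $\rho(M)$ with the same row set $I\ni 1$ and same column set $J$ as a minor of $M$ of this kind) is an integer.
   Context: For a matrix $M$: $\gamma_{s,m}(M)$ is the matrix obtained from $M$ by multiplying its first row by $m$ and multiplying its $s$-th column by $\frac1m$ (so the entry in position $(1,s)$ is unchanged). $\epsilon_{s,l,h}(M)$ is the matrix obtained from $M$ by adding $h$ times its $s$-th column to its $l$-th column. *)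

(* Defs.v *)
From mathcomp Require Export all_boot all_order all_algebra.
From mathcomp Require Export reals.

Set Implicit Arguments.
Unset Strict Implicit.
Unset Printing Implicit Defensive.

Import GRing.Theory Num.Theory.
Local Open Scope ring_scope.

(* Rows and columns are indexed from 0, so the first row of a matrix is
   [ord0]. *)

Definition gamma (R : realType) (p q : nat) (s : 'I_q) (m : int)
    (M : 'M[R]_(p.+1, q)) : 'M[R]_(p.+1, q) :=
  \matrix_(i, j) ((if i == ord0 then m%:~R else 1) *
                  (if j == s then 1 / m%:~R else 1) * M i j).

Definition epsilon (R : realType) (p q : nat) (s l : 'I_q) (h : int)
    (M : 'M[R]_(p.+1, q)) : 'M[R]_(p.+1, q) :=
  \matrix_(i, j) (if j == l then M i l + h%:~R * M i s else M i j).

(* The minor with row set I and column set J; [enum_val] lists the elements of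
   a set of ordinals in increasing order. *)
Definition minor (R : realType) (p q k : nat) (M : 'M[R]_(p, q))
    (I : {set 'I_p}) (J : {set 'I_q}) (hI : #|I| = k) (hJ : #|J| = k) : R :=
  \det (mxsub (fun a : 'I_k => enum_val (cast_ord (esym hI) a))
              (fun b : 'I_k => enum_val (cast_ord (esym hJ) b)) M).

Definition first_row_minors_int (R : realType) (p q k : nat)
    (M : 'M[R]_(p.+1, q)) : Prop :=
  forall (I : {set 'I_p.+1}) (J : {set 'I_q}) (hI : #|I| = k) (hJ : #|J| = k),
    ord0 \in I -> minor M hI hJ \is a Num.int.

(* Main.v *)
Require Import Defs.
From mathcomp Require Import all_boot all_order all_algebra.
From mathcomp Require Import perm reals.

Set Implicit Arguments.
Unset Strict Implicit.
Unset Printing Implicit Defensive.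

Import GRing.Theory Num.Theory.
Local Open Scope ring_scope.

(** The operation [gamma s m] multiplies a minor through the first row by [m],
    and by [m * (1 / m) = 1] when its column set contains [s].  For
    [epsilon s l h], multilinearity in column [l] writes a minor of the new
    matrix as a minor of [M] plus [h] times the determinant in which column [l]
    is replaced by column [s]; the latter determinant has a repeated column or
    is, up to a permutation of its columns, again a minor of [M] with the same
    rows. *)

Lemma det_mxsub_noninj (R : comNzRingType) (p q k : nat) (M : 'M[R]_(p, q))
    (f : 'I_k -> 'I_p) (g : 'I_k -> 'I_q) :
  ~~ injectiveb g -> \det (mxsub f g M) = 0.
Proof.
case/injectivePn=> b [b' bb' gbb'].
by rewrite -det_tr (determinant_alternate bb') // => a; rewrite !mxE gbb'.
Qed.

(** Scaling rows and columns is multiplication on the left and on the right by diagonal matrices,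
    whose determinants are the two products. *)
Lemma det_mxsub_scale (R : comNzRingType) (p q k : nat) (M : 'M[R]_(p, q))
    (d : 'I_p -> R) (e : 'I_q -> R) (f : 'I_k -> 'I_p) (g : 'I_k -> 'I_q) :
  \det (mxsub f g (\matrix_(i, j) (d i * e j * M i j))) =
  (\prod_a d (f a)) * (\prod_b e (g b)) * \det (mxsub f g M).
Proof.
have -> : mxsub f g (\matrix_(i, j) (d i * e j * M i j)) =
    diag_mx (\row_a d (f a)) *m mxsub f g M *m diag_mx (\row_b e (g b)).
  by apply/matrixP=> a b; rewrite mul_mx_diag mul_diag_mx !mxE mulrAC.
rewrite !det_mulmx !det_diag mulrAC; congr (_ * _ * _);
  by apply: eq_bigr => a _; rewrite mxE.
Qed.

(** Injectivity leaves at most one factor different from 1. *)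
Lemma prod_inj_pred1 (R : comNzRingType) (T : eqType) (k : nat)
    (f : 'I_k -> T) (x : T) (c : R) :
  injective f ->
  \prod_a (if f a == x then c else 1) = if x \in codom f then c else 1.
Proof.
move=> f_inj; case: ifPn => [/codomP[a0 ->] | xNf].
  rewrite (bigD1 a0) //= eqxx big1 ?mulr1 // => a /negPf aa0.
  by rewrite (inj_eq f_inj) aa0.
rewrite big1 // => a _; case: eqP => // fa.
by rewrite -fa codom_f in xNf.
Qed.

Lemma enum_val_cast_inj (T : finType) (A : {set T}) (k : nat) (hA : #|A| = k) :
  injective (fun a : 'I_k => enum_val (cast_ord (esym hA) a)).
Proof. by move=> a b /enum_val_inj/cast_ord_inj. Qed.

Lemma codom_enum_val_cast (T : finType) (A : {set T}) (k : nat)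
    (hA : #|A| = k) (x : T) :
  x \in A -> x \in codom (fun a : 'I_k => enum_val (cast_ord (esym hA) a)).
Proof.
move=> xA; apply/codomP; exists (cast_ord hA (enum_rank_in xA x)).
by rewrite cast_ordK enum_rankK_in.
Qed.

(** Frees the columns from the increasing order built into [minor]: a repeated column gives 0, and
    sorting distinct columns costs only a sign. *)
Lemma first_row_mxsub_int (R : realType) (p q k : nat) (M : 'M[R]_(p.+1, q))
    (I : {set 'I_p.+1}) (hI : #|I| = k) (g : 'I_k -> 'I_q) :
  first_row_minors_int k M -> ord0 \in I ->
  \det (mxsub (fun a => enum_val (cast_ord (esym hI) a)) g M) \is a Num.int.
Proof.
move=> Mint I0; have [/injectiveP g_inj|gN] := boolP (injectiveb g); last first.
  by rewrite det_mxsub_noninj // rpred0.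
pose J := [set g b | b in 'I_k].
have hJ : #|J| = k by rewrite card_imset ?card_ord.
have gJ b : g b \in J by apply: imset_f.
(* [sf b] is the rank of column [g b] in the increasing enumeration of [J], so [sf] is the
   permutation that sorts [g]. *)
pose sf b := cast_ord hJ (enum_rank_in (gJ b) (g b)).
have sfE b : enum_val (cast_ord (esym hJ) (sf b)) = g b.
  by rewrite cast_ordK enum_rankK_in.
have sf_inj : injective sf by move=> b c e; apply: g_inj; rewrite -!sfE e.
have := Mint I J hI hJ I0; rewrite /minor.
set A := mxsub _ _ M => Aint.
have -> : mxsub (fun a => enum_val (cast_ord (esym hI) a)) g M =
    col_perm (perm sf_inj) A.
  by apply/matrixP=> a b; rewrite !mxE permE sfE.
by rewrite col_permE det_mulmx det_perm rpredM // rpredX // rpredN rpred1.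
Qed.

Lemma gamma_first_row_minors_int (R : realType) (p q k : nat) (s : 'I_q)
    (m : int) (M : 'M[R]_(p.+1, q)) :
  m != 0 -> first_row_minors_int k M -> first_row_minors_int k (gamma s m M).
Proof.
move=> m0 Mint I J hI hJ I0; rewrite /minor /gamma.
rewrite (det_mxsub_scale M (fun i => if i == ord0 then m%:~R else 1)
  (fun j => if j == s then 1 / m%:~R else 1)).
rewrite !prod_inj_pred1; do ?exact: enum_val_cast_inj.
(* As [ord0 \in I], the row product is exactly [m]; the remaining cases are whether column [s] is
   selected. *)
rewrite codom_enum_val_cast // rpredM ?Mint //.
case: ifP => _; first by rewrite mul1r divff ?intr_eq0 // rpred1.
by rewrite mulr1 intr_int.
Qed.

(** Since [g] is injective, column [l] is selected only at position [b0], so the two submatrices of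
    [M] and that of [epsilon s l h M] differ in that single column. *)
Lemma det_mxsub_epsilon (R : realType) (p q k : nat) (s l : 'I_q) (h : int)
    (M : 'M[R]_(p.+1, q)) (f : 'I_k -> 'I_p.+1) (g : 'I_k -> 'I_q) (b0 : 'I_k) :
  injective g -> g b0 = l ->
  \det (mxsub f g (epsilon s l h M)) = \det (mxsub f g M) +
    h%:~R * \det (mxsub f (fun b => if b == b0 then s else g b) M).
Proof.
move=> g_inj gb0; rewrite -det_tr -[\det (mxsub f g M)]det_tr.
rewrite -[\det (mxsub f (fun b => _) M)]det_tr -[X in X + _]mul1r.
apply: (determinant_multilinear (i0 := b0)).
- by apply/rowP=> a; rewrite !mxE gb0 !eqxx mul1r.
- apply/matrixP=> b a; rewrite !mxE -gb0 (inj_eq g_inj) eq_sym.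
  by rewrite (negPf (neq_lift _ _)).
- apply/matrixP=> b a; rewrite !mxE -gb0 (inj_eq g_inj) eq_sym.
  by rewrite (negPf (neq_lift _ _)).
Qed.

Lemma epsilon_first_row_minors_int (R : realType) (p q k : nat) (s l : 'I_q)
    (h : int) (M : 'M[R]_(p.+1, q)) :
  first_row_minors_int k M -> first_row_minors_int k (epsilon s l h M).
Proof.
move=> Mint I J hI hJ I0; rewrite /minor.
set g := (X in mxsub _ X _).
have g_inj : injective g by exact: enum_val_cast_inj.
have [/codomP[b0 gb0]|lNg] := boolP (l \in codom g).
  rewrite (det_mxsub_epsilon _ _ _ _ g_inj (esym gb0)).
  by rewrite rpredD ?rpredM ?intr_int ?first_row_mxsub_int.
(* Column [l] is not selected here, so the submatrix is unchanged. *)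
set f := (X in mxsub X _ _).
have -> : mxsub f g (epsilon s l h M) = mxsub f g M.
  apply/matrixP=> a b; rewrite !mxE; case: eqP => // gb.
  by rewrite -gb codom_f in lNg.
exact: first_row_mxsub_int.
Qed.

Theorem theorem10 (R : realType) (p q k : nat) (M : 'M[R]_(p.+1, q))
    (rho : 'M[R]_(p.+1, q) -> 'M[R]_(p.+1, q)) :
  (0 < k)%N ->
  (exists (s : 'I_q) (m : int), m != 0 /\ rho = gamma s m) \/
  (exists (s l : 'I_q) (h : int), s != l /\ rho = epsilon s l h) ->
  first_row_minors_int k M ->
  first_row_minors_int k (rho M).
Proof.
move=> _ [[s [m [m0 ->]]] | [s [l [h [_ ->]]]]].
  exact: gamma_first_row_minors_int.
exact: epsilon_first_row_minors_int.
Qed.
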